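(* Let $X$ be a uniformly convex and uniformly smooth Banach space and let $C$ be a proper closed subspace of $X$. Then $P_C$ is directionally differentiable at every point $y\in C$ along any direction $v\in C^{\perp}\setminus\{\theta\}$ such that $$P_C'(y;v)=\theta,\quad\text{for any } v\in C^{\perp}\text{ with } v\neq\theta.$$
   Context: All Banach spaces are real and $\theta$ is the origin. $J:X\to X^*$ is the (single-valued) normalized duality mapping: $\langle Jx,x\rangle=\|Jx\|_*^2=\|x\|^2$, where $\langle\cdot,\cdot\rangle$ is the pairing between $X^*$ and $X$. For a proper closed subspace $C$, $C^{\perp}=\{x\in X:\langle Jx,z\rangle=0\text{ for all }z\in C\}$. $P_C:X\to C$ is the (single-valued) metric projection: $\|x-P_C(x)\|\le\|x-z\|$ for all $z\in C$. $P_C$ is directionally differentiable at $x$ along direction $v\neq\theta$ if the norm limit $P_C'(x;v)=\lim_{t\downarrow0}\frac{P_C(x+tv)-P_C(x)}{t}$ exists in $X$. *)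

(* Defs.v *)
From HB Require Import structures.
From mathcomp Require Import all_boot all_order all_algebra.
From mathcomp Require Import all_classical all_reals all_analysis.
Set Implicit Arguments.
Unset Strict Implicit.
Unset Printing Implicit Defensive.
Import Order.TTheory GRing.Theory Num.Theory.
Import numFieldNormedType.Exports.
Local Open Scope classical_set_scope.
Local Open Scope ring_scope.

Definition uniformly_convex (R : realType) (X : normedModType R) : Prop :=
  forall e : R, 0 < e <= 2 ->
  exists2 d : R, 0 < d &
    forall x y : X, `|x| = 1 -> `|y| = 1 -> e <= `|x - y| ->
      `|2^-1 *: (x + y)| <= 1 - d.

(* This is rho(t) / t --> 0 as t --> 0+ for the modulus of smoothness
   rho(t) = sup { (|x + y| + |x - y|) / 2 - 1 : |x| = 1, |y| = t }. *)
Definition uniformly_smooth (R : realType) (X : normedModType R) : Prop :=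
  forall e : R, 0 < e ->
  exists2 d : R, 0 < d &
    forall x y : X, `|x| = 1 -> `|y| <= d ->
      `|x + y| + `|x - y| <= 2 + e * `|y|.

Record dual (R : realType) (X : normedModType R) := Dual {
  dual_fun :> {linear X -> R^o} ;
  dual_continuous : continuous dual_fun }.

HB.instance Definition _ (R : realType) (X : normedModType R) :=
  gen_eqMixin (dual X).
HB.instance Definition _ (R : realType) (X : normedModType R) :=
  gen_choiceMixin (dual X).

Lemma null_fun_continuous (R : realType) (X : normedModType R) :
  continuous (\0%R : {linear X -> R^o}).
Proof. by move=> x; exact: cvg_cst. Qed.

Definition dual0 (R : realType) (X : normedModType R) : dual X :=
  Dual (@null_fun_continuous R X).

Definition dual_norm (R : realType) (X : normedModType R) (f : dual X) : R :=
  sup [set `|f x| | x in [set x : X | `|x| <= 1]].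

Definition duality_set (R : realType) (X : normedModType R) (x : X) :
    set (dual X) :=
  [set f : dual X | f x = dual_norm f ^+ 2 /\ dual_norm f ^+ 2 = `|x| ^+ 2].

(* [duality_set x] is nonempty by Hahn-Banach, and a singleton as soon as the
   norm is smooth, so the default [dual0] is never used. *)
Definition duality_map (R : realType) (X : normedModType R) (x : X) : dual X :=
  xget (dual0 X) (duality_set x).

Definition perp (R : realType) (X : normedModType R) (C : set X) : set X :=
  [set x : X | forall z, C z -> duality_map x z = 0].

Definition nearest_points (R : realType) (X : normedModType R) (C : set X)
    (x : X) : set X :=
  [set p : X | C p /\ forall z, C z -> `|x - p| <= `|x - z|].

(* In a uniformly convex Banach space, a nonempty closed convex [C] has exactly
   one nearest point to each [x], so the default [0] is never used. *)
Definition metric_projection (R : realType) (X : normedModType R) (C : set X)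
    (x : X) : X :=
  xget 0 (nearest_points C x).

Definition dir_quotient (R : realType) (X Y : normedModType R) (f : X -> Y)
    (x v : X) (t : R) : Y :=
  t^-1 *: (f (x + t *: v) - f x).

Definition directionally_differentiable (R : realType) (X Y : normedModType R)
    (f : X -> Y) (x v : X) : Prop :=
  cvg (dir_quotient f x v t @[t --> 0^'+]).

Definition directional_derivative (R : realType) (X Y : normedModType R)
    (f : X -> Y) (x v : X) : Y :=
  lim (dir_quotient f x v t @[t --> 0^'+]).

Definition closed_subspace (R : realType) (X : normedModType R)
    (C : set X) : Prop :=
  GRing.submod_closed (mem C) /\ closed C.

(* Main.v *)
Require Import Defs.
From HB Require Import structures.
From mathcomp Require Import all_boot all_order all_algebra.
From mathcomp Require Import all_classical all_reals all_analysis.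
From mathcomp Require Import ring lra.
Set Implicit Arguments.
Unset Strict Implicit.
Unset Printing Implicit Defensive.
Import Order.TTheory GRing.Theory Num.Theory.
Import numFieldNormedType.Exports.
Local Open Scope classical_set_scope.
Local Open Scope ring_scope.

(** If [v] lies in [C^perp], then [P_C (y + t *: v) = y] for every [y] in [C]
    and every [t], so all difference quotients at [y] along [v] vanish and so
    does their limit.

    The functional [J v] has norm [|v|], takes the value [|v| ^ 2] at [v] and
    kills [C]; hence [|v| ^ 2 = J v (v - z) <= |v| * |v - z|] for [z] in [C],
    that is, [v] is Birkhoff orthogonal to [C] ([perp_birkhoff]).  This relation
    is stable under scaling, and for a vector [w] satisfying it, [y] is a nearest
    point of [C] to [y + w].  It is the only one: two nearest points would give
    two vectors of the same norm whose midpoint is not shorter, which uniform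
    convexity excludes ([metric_projection_birkhoff]).

    This argument needs [J v] to be a genuine element of the duality set of [v].
    Uniform smoothness yields one without extending functionals: for a unit
    vector [u], the one-sided directional derivative of the norm at [u] is
    always sublinear and bounded by the norm, and smoothness makes it odd, hence
    linear ([norm_deriv_linear]).  Scaled by [|v|], the derivative at [v / |v|]
    belongs to the duality set of [v] ([duality_set_nonempty]). *)

(** * The derivative of a smooth norm *)

(** This is the limit of [(|u + t *: z| - |u|) / t] as [t] tends to [0+], for a
    unit vector [u].  The quotient is nondecreasing in [t], so the limit is an
    infimum, and the substitution [s = 1 / t] turns the quotient into
    [|s *: u + z| - s], which is jointly convex and positively homogeneous in
    [(s, z)]. *)
Definition norm_deriv (R : realType) (X : normedModType R) (u z : X) : R :=
  inf [set `|s *: u + z| - s | s in [set s : R | 0 < s]].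

Section NormDerivative.
Context (R : realType) (X : normedModType R) (u : X).
Hypothesis u1 : `|u| = 1.

Lemma norm_shift_ge (s : R) (z : X) : 0 < s -> - `|z| <= `|s *: u + z| - s.
Proof.
move=> s0; have := ler_normB (s *: u + z) z.
by rewrite addrK normrZ u1 mulr1 gtr0_norm//; lra.
Qed.

Lemma norm_deriv_ge (z : X) (m : R) :
  (forall s, 0 < s -> m <= `|s *: u + z| - s) -> m <= norm_deriv u z.
Proof.
move=> H; apply: lb_le_inf; first by exists (`|1 *: u + z| - 1), 1 => /=.
by move=> _ [s /= s0 <-]; exact: H.
Qed.

Lemma norm_deriv_le (s : R) (z : X) :
  0 < s -> norm_deriv u z <= `|s *: u + z| - s.
Proof.
move=> s0; apply: ge_inf; last by exists s.
by exists (- `|z|) => _ [r /= r0 <-]; exact: norm_shift_ge.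
Qed.

Lemma norm_deriv_le_norm (z : X) : norm_deriv u z <= `|z|.
Proof.
apply: le_trans (norm_deriv_le z ltr01) _.
by have := ler_normD (1 *: u) z; rewrite scale1r u1; lra.
Qed.

Lemma norm_deriv_self : norm_deriv u u = 1.
Proof.
have E s : 0 < s -> `|s *: u + u| - s = 1.
  move=> s0; rewrite -[X in `|_ + X|]scale1r -scalerDl normrZ u1 mulr1 gtr0_norm.
    by rewrite addrC addKr.
  by rewrite addr_gt0.
apply/eqP; rewrite eq_le norm_deriv_ge ?andbT => [|s /E -> //].
by rewrite (le_trans (norm_deriv_le u ltr01))// E.
Qed.

(** Near-optimal parameters [s] for [x] and [t] for [y] add up to the competitor
    [s + t] for [x + y], by the triangle inequality. *)
Lemma norm_deriv_subadditive (x y : X) :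
  norm_deriv u (x + y) <= norm_deriv u x + norm_deriv u y.
Proof.
rewrite -lerBlDr; apply: norm_deriv_ge => s s0.
rewrite lerBlDr -lerBlDl; apply: norm_deriv_ge => t t0.
have := norm_deriv_le (x + y) (addr_gt0 s0 t0).
have := ler_normD (s *: u + x) (t *: u + y).
by rewrite addrACA -scalerDl; lra.
Qed.

Lemma norm_deriv_scale_le (c : R) (x : X) :
  0 < c -> norm_deriv u (c *: x) <= c * norm_deriv u x.
Proof.
move=> c0; rewrite -ler_pdivrMl//; apply: norm_deriv_ge => s s0.
rewrite ler_pdivrMl//; apply: le_trans (@norm_deriv_le (c * s) _ _) _.
  exact: mulr_gt0.
by rewrite -scalerA -scalerDr normrZ gtr0_norm// mulrBr.
Qed.

Lemma norm_deriv_scale_gt0 (c : R) (x : X) :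
  0 < c -> norm_deriv u (c *: x) = c * norm_deriv u x.
Proof.
move=> c0; apply/eqP; rewrite eq_le norm_deriv_scale_le//=.
rewrite -ler_pdivlMl//; apply: le_trans (@norm_deriv_scale_le c^-1 _ _).
  by rewrite scalerA mulVf ?gt_eqF// scale1r.
by rewrite invr_gt0.
Qed.

Hypothesis smooth : uniformly_smooth X.

(** Smoothness at [u] bounds [(|s *: u + x| - s) + (|s *: u - x| - s)] by an
    arbitrarily small multiple of [|x|] once [s] is large. *)
Lemma norm_derivN_le (x : X) : norm_deriv u x + norm_deriv u (- x) <= 0.
Proof.
apply/ler_addgt0Pl => e e0; rewrite addr0.
(* dividing by [|x| + 1] rather than [|x|] covers the case [x = 0] *)
have n0 : 0 < `|x| + 1 by rewrite ltr_wpDl.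
have [d d0 H] := smooth (divr_gt0 e0 n0).
pose s := (`|x| + 1) / d; have s0 : 0 < s by exact: divr_gt0.
have xs : `|s^-1 *: x| = `|x| / s.
  by rewrite normrZ gtr0_norm ?invr_gt0// mulrC.
have xd : `|s^-1 *: x| <= d.
  by rewrite xs ler_pdivrMr// /s mulrC divfK ?gt_eqF// lerDl.
have := H u (s^-1 *: x) u1 xd.
have E w : s * `|u + s^-1 *: w| = `|s *: u + w|.
  rewrite -[X in X * _](gtr0_norm s0) -normrZ scalerDr scalerA divff ?gt_eqF//.
  by rewrite scale1r.
rewrite -scalerN -(ler_pM2l s0) mulrDr !E xs.
have := norm_deriv_le x s0; have := norm_deriv_le (- x) s0.
have : s * (e / (`|x| + 1) * (`|x| / s)) <= e.
  rewrite [leLHS](_ : _ = e * (`|x| / (`|x| + 1))); last first.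
    by field; rewrite !gt_eqF.
  by rewrite ler_piMr ?(ltW e0)// ler_pdivrMr// mul1r lerDl.
by rewrite mulrDr; lra.
Qed.

Lemma norm_deriv0 : norm_deriv u 0 = 0.
Proof.
apply/eqP; rewrite eq_le -[in leRHS](normr0 X) norm_deriv_le_norm/=.
by apply: norm_deriv_ge => s s0; rewrite addr0 normrZ u1 mulr1 gtr0_norm// subrr.
Qed.

(** Subadditivity gives one inequality and smoothness the other; an odd
    sublinear function is then linear. *)
Lemma norm_derivN (x : X) : norm_deriv u (- x) = - norm_deriv u x.
Proof.
have := norm_deriv_subadditive x (- x); rewrite subrr norm_deriv0.
by have := norm_derivN_le x; lra.
Qed.

Lemma norm_deriv_linear : linear (norm_deriv u : X -> R^o).
Proof.
have D x y : norm_deriv u (x + y) = norm_deriv u x + norm_deriv u y.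
  have := norm_deriv_subadditive x y.
  have := norm_deriv_subadditive (- x) (- y).
  by rewrite -opprD !norm_derivN; lra.
move=> a x y; rewrite D; congr (_ + _).
change (norm_deriv u (a *: x) = a * norm_deriv u x).
have [a0|a0|->] := ltgtP a 0.
- rewrite -[a]opprK scaleNr norm_derivN norm_deriv_scale_gt0 ?oppr_gt0//.
  by rewrite [in RHS]mulNr.
- exact: norm_deriv_scale_gt0.
- by rewrite scale0r mul0r norm_deriv0.
Qed.

End NormDerivative.

(** * The duality mapping *)

Lemma bounded_functional_dual (R : realType) (X : normedModType R) (g : X -> R)
    (M : R) : linear (g : X -> R^o) -> (forall x, `|g x| <= M * `|x|) ->
  exists f : dual X, f =1 g.
Proof.
move=> lg gM.
pose f : {linear X -> R^o} := HB.pack (g : X -> R^o)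
  (GRing.isLinear.Build _ _ _ _ _ lg).
suff cf : continuous f by exists (Dual cf).
apply: bounded_linear_continuous; apply/linear_boundedP.
near=> r => x; apply: le_trans (gM x) _.
by rewrite ler_wpM2r//; near: r; apply: nbhs_pinfty_ge; rewrite num_real.
Unshelve. all: by end_near. Qed.

Lemma dual_norm_has_ubound (R : realType) (X : normedModType R) (f : dual X) :
  has_ubound [set `|f x| | x in [set x : X | `|x| <= 1]].
Proof.
have /linear_boundedP := continuous_linear_bounded 0 (@dual_continuous _ _ f 0).
move=> /pinfty_ex_gt0[M M0 fM]; exists M => _ [x /= x1 <-].
by rewrite (le_trans (fM x))// ler_piMr// ltW.
Qed.

Lemma dual_norm_ge (R : realType) (X : normedModType R) (f : dual X) (x : X) :
  `|f x| <= dual_norm f * `|x|.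
Proof.
have [->|x0] := eqVneq x 0; first by rewrite linear0 !normr0 mulr0.
have n0 : 0 < `|x| by rewrite normr_gt0.
rewrite -ler_pdivrMr// mulrC -[X in X * _](@gtr0_norm _ `|x|^-1) ?invr_gt0//.
rewrite -normrM.
have -> : `|x|^-1 * f x = f (`|x|^-1 *: x) by rewrite linearZ.
apply: ub_le_sup; first exact: dual_norm_has_ubound.
exists (`|x|^-1 *: x) => //=.
by rewrite normrZ gtr0_norm ?invr_gt0// mulVf ?gt_eqF.
Qed.

Lemma dual_norm_eq (R : realType) (X : normedModType R) (f : dual X) (u : X)
    (r : R) : `|u| = 1 -> f u = r -> (forall x, `|f x| <= r * `|x|) ->
  dual_norm f = r.
Proof.
move=> u1 fu fr.
have r0 : 0 <= r by have := fr u; rewrite u1 mulr1; apply: le_trans.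
apply/eqP; rewrite eq_le; apply/andP; split.
  apply: ge_sup; first by exists `|f u|, u => //=; rewrite u1.
  by move=> _ [x /= x1 <-]; rewrite (le_trans (fr x))// ler_piMr.
have := dual_norm_ge f u; rewrite u1 mulr1 fu.
exact: le_trans (ler_norm _).
Qed.

(** The witness is [|v|] times the derivative of the norm at [v / |v|]: that
    derivative has norm [1], attained at [v / |v|]. *)
Lemma duality_set_nonempty (R : realType) (X : normedModType R) (v : X) :
  uniformly_smooth X -> v != 0 -> duality_set v !=set0.
Proof.
move=> sm v0; have n0 : 0 < `|v| by rewrite normr_gt0.
pose u := `|v|^-1 *: v.
have u1 : `|u| = 1 by rewrite normrZ gtr0_norm ?invr_gt0// mulVf ?gt_eqF.
have lin := norm_deriv_linear u1 sm.
pose g z := `|v| * norm_deriv u z.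
have lg : linear (g : X -> R^o).
  move=> a x y; rewrite /g lin mulrDr; congr (_ + _).
  exact: mulrCA.
have gM x : `|g x| <= `|v| * `|x|.
  rewrite /g normrM normr_id ler_wpM2l// ler_norml norm_deriv_le_norm//.
  by rewrite lerNl -norm_derivN// -[in leRHS]normrN norm_deriv_le_norm.
have [f fg] := bounded_functional_dual lg gM.
have fu : f u = `|v| by rewrite fg /g norm_deriv_self// mulr1.
have nf : dual_norm f = `|v|.
  by apply: (dual_norm_eq u1 fu) => x; rewrite fg.
exists f; split; rewrite nf//.
have -> : v = `|v| *: u by rewrite /u scalerA divff ?gt_eqF// scale1r.
by rewrite linearZ/= fu normrZ normr_id u1 mulr1.
Qed.

(** * Orthogonality and the metric projection *)

(** Equivalently, the origin is a nearest point of [C] to [w] when [C] is a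
    subspace. *)
Definition birkhoff_orthogonal (R : realType) (X : normedModType R) (C : set X)
    (w : X) : Prop :=
  forall z, C z -> `|w| <= `|w - z|.

(** Compare [J v (v - z) = |v| ^ 2] with the bound [|v| * |v - z|]. *)
Lemma perp_birkhoff (R : realType) (X : normedModType R) (C : set X) (v : X) :
  uniformly_smooth X -> perp C v -> birkhoff_orthogonal C v.
Proof.
move=> sm pv z Cz; have [->|v0] := eqVneq v 0; first by rewrite normr0.
have n0 : 0 < `|v| by rewrite normr_gt0.
have [f0 f0v] := duality_set_nonempty sm v0.
have [fv nf] : duality_set v (duality_map v).
  exact: (xgetPex _ (ex_intro _ f0 f0v)).
move: (pv z Cz) fv nf; set f := duality_map v => fz fv nf.
have fN : dual_norm f = `|v|.
  have N0 : 0 <= dual_norm f.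
    by have := le_trans (normr_ge0 _) (dual_norm_ge f v); rewrite pmulr_lge0.
  by apply/eqP; rewrite -(eqrXn2 (n := 2))// nf.
have := dual_norm_ge f (v - z).
rewrite linearB/= fz subr0 fv fN normrX normr_id expr2.
by rewrite ler_pM2l.
Qed.

Lemma birkhoff_orthogonalZ (R : realType) (X : normedModType R) (C : set X)
    (w : X) (t : R) :
  (forall a z, C z -> C (a *: z)) ->
  birkhoff_orthogonal C w -> birkhoff_orthogonal C (t *: w).
Proof.
move=> CZ ow z Cz; have [->|t0] := eqVneq t 0; first by rewrite scale0r normr0.
have -> : t *: w - z = t *: (w - t^-1 *: z).
  by rewrite scalerBr scalerA divff// scale1r.
by rewrite !normrZ ler_wpM2l//; apply/ow/CZ.
Qed.

(** After normalization, the modulus of convexity at [|a - b| / |b|] would make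
    the midpoint of distinct vectors strictly shorter. *)
Lemma uniformly_convex_strict (R : realType) (X : normedModType R) (a b : X) :
  uniformly_convex X -> `|a| = `|b| -> `|b| <= `|2^-1 *: (a + b)| -> a = b.
Proof.
move=> cv ab mid; have [b0|b0] := eqVneq b 0.
  by apply/eqP; rewrite b0 -normr_eq0 ab b0 normr0.
have n0 : 0 < `|b| by rewrite normr_gt0.
have n0' : 0 < `|b|^-1 by rewrite invr_gt0.
apply/eqP; rewrite -subr_eq0; apply/negPn/negP => d0.
pose a' := `|b|^-1 *: a; pose b' := `|b|^-1 *: b.
have a1 : `|a'| = 1 by rewrite normrZ gtr0_norm// ab mulVf ?gt_eqF.
have b1 : `|b'| = 1 by rewrite normrZ gtr0_norm// mulVf ?gt_eqF.
have e02 : 0 < `|a' - b'| <= 2.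
  apply/andP; split; last by rewrite (le_trans (ler_normB _ _))// a1 b1.
  by rewrite -scalerBr normrZ mulr_gt0 ?normr_gt0// gt_eqF.
have [d dp H] := cv _ e02.
have := H _ _ a1 b1 (lexx _).
rewrite -scalerDr scalerA mulrC -scalerA normrZ gtr0_norm// ler_pdivrMl// => M.
have := le_trans mid M.
by rewrite ler_pMr//; lra.
Qed.

(** With [z = p - y] in [C], a nearest point [p] satisfies [|w - z| = |w|],
    while the midpoint [w - z / 2] of [w - z] and [w] is at least as long as [w]
    by orthogonality; strict convexity forces [z = 0]. *)
Lemma metric_projection_birkhoff (R : realType) (X : normedModType R)
    (C : set X) (y w : X) :
  uniformly_convex X -> GRing.submod_closed (mem C) -> C y ->
  birkhoff_orthogonal C w -> metric_projection C (y + w) = y.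
Proof.
move=> cv [_ Clin] Cy ow.
have CL a p q : C p -> C q -> C (a *: p + q).
  by move=> /mem_set Cp /mem_set Cq; apply/set_mem/Clin.
have CB p q : C p -> C q -> C (p - q).
  by move=> Cp Cq; rewrite addrC -scaleN1r; exact: CL.
have shift p : y + w - p = w - (p - y) by rewrite opprB addrCA addrA.
apply: xget_unique => [|p [Cp pmin]].
  split=> // z Cz; rewrite !shift subrr subr0; exact/ow/CB.
have Cz := CB p y Cp Cy; set z := p - y in Cz.
suff : w - z = w.
  move/eqP; rewrite -subr_eq0 addrAC subrr sub0r oppr_eq0 subr_eq0.
  by move/eqP.
apply: uniformly_convex_strict => //.
  apply/eqP; rewrite eq_le ow// andbT.
  by have := pmin y Cy; rewrite !shift subrr subr0.
have -> : 2^-1 *: (w - z + w) = w - 2^-1 *: z.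
  by rewrite addrAC scalerBr -mulr2n -(scaler_nat 2 w) scalerA mulVf ?scale1r//.
apply: ow; rewrite -[_ *: z]addr0; apply: CL => //.
by rewrite -(subrr y); exact: CB.
Qed.

Theorem theorem6p1 (R : realType) (X : completeNormedModType R)
    (hconvex : uniformly_convex X) (hsmooth : uniformly_smooth X)
    (C : set X) (hC : closed_subspace C) (hproper : C <> setT)
    (y v : X) (hy : C y) (hv : perp C v) (hv0 : v <> 0) :
  directionally_differentiable (metric_projection C) y v /\
  directional_derivative (metric_projection C) y v = 0.
Proof.
have [Csub _] := hC.
have CZ a z : C z -> C (a *: z).
  move=> /mem_set Cz; apply/set_mem; rewrite -[_ *: _]addr0.
  by apply: (Csub.2) => //; exact: Csub.1.
have P t : metric_projection C (y + t *: v) = y.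
  apply: metric_projection_birkhoff => //.
  by apply: birkhoff_orthogonalZ => //; exact: perp_birkhoff.
have Q : dir_quotient (metric_projection C) y v = cst 0.
  apply/funext => t; rewrite /dir_quotient P.
  by have := P 0; rewrite scale0r addr0 => ->; rewrite subrr scaler0.
rewrite /directionally_differentiable /directional_derivative Q.
by split; [exact: is_cvg_cst|exact: lim_cst].
Qed.
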